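(* Let $p$ be a prime, $k\ge1$ a natural number and $N=p^k$. Let $F_{N}$ be the unitary Fourier matrix, $[F_N]_{i,j}=\frac1{\sqrt N}e^{\mathbf i\frac{2\pi}{N}(i-1)(j-1)}$. Let $\mathcal P$ be the real vector space of all parameter cycle matrices $P$ of size $N$ satisfying (1) $P^{j,0}=0$ for $j\in\{1,\dots,\frac{p^k-1}{2}\}$ if $p\ne2$, and for $j\in\{1,\dots,\frac{p^k}{2}\}$ if $p=2$; (2) $P^{0,i}=-\sum_{j=2}^{p^k}P_{i+1,j}$ for $i\in\{0,\dots,p^k-1\}$. Then the set $$\big\{\mathrm{vec}_{\mathbb R}\big(F_{p^k}\circ\mathrm{EXP}(\mathbf i\,PF_{p^k})\big): P\in\mathcal P\big\}$$ is a $\mathbf d(F_{p^k})$-parameter family (i.e. $\dim_{\mathbb R}\mathcal P=\mathbf d(F_{p^k})$), it is a differentiable manifold containing (stemming from) $\mathrm{vec}_{\mathbb R}(F_{p^k})$, and all its elements are of the form $\mathrm{vec}_{\mathbb R}(V)$ where $V$ is a unitary complex Hadamard matrix dephased with respect to $F_{p^k}$.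
   Context: For a complex $N\times N$ matrix $A$, $\mathrm{vec}_{\mathbb R}(A)\in\mathbb R^{2N^2}$ is the vector of real parts of the entries (row by row) followed by the vector of imaginary parts. $\circ$ is the entrywise (Hadamard) product; $\mathrm{EXP}(A)$ is the entrywise exponential, $[\mathrm{EXP}(A)]_{i,j}=\exp(A_{i,j})$. A unitary complex Hadamard matrix of size $N$ is a unitary $V$ with $|V_{i,j}|=1/\sqrt N$ for all $i,j$; here it is called dephased with respect to $F_{N}$ if all entries of its first row and first column equal those of $F_N$, i.e. equal $1/\sqrt N$. Defect: let $f$ send a complex $N\times N$ matrix $U$ to $(|U_{i,j}|^2)_{i,j}$, with (real) differential $Df_U(V)=\big(2\,\mathrm{Re}(\overline{U_{i,j}}V_{i,j})\big)_{i,j}$; for unitary $U$ let $T_U=\{EU:E^*=-E\}$. Then $\mathbf d(U)=(N-1)^2-\dim_{\mathbb R}Df_U(T_U)$. Parameter cycle matrix (PCM) of size $N$: a complex $N\times N$ matrix $P$ built as follows, where $P^{x,y}$ (step index $x$, cycle index $y$) denote its free parameters and row indices are taken modulo $N$ in $\{1,\dots,N\}$. - The first column consists of arbitrary real numbers $P^{0,0},\dots,P^{0,N-1}$ from top to bottom, i.e. $P_{i+1,1}=P^{0,i}$. - For each $j\in\{2,\dots,\frac{N+1}2\}$ if $N$ is odd, or $j\in\{2,\dots,\frac N2\}$ if $N$ is even, and each $m=1,2,\dots,\frac{N}{\mathrm{lcm}(N,j-1)/(j-1)}=\gcd(N,j-1)$, there is an arbitrary complex parameter $P^{j-1,m-1}$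 such that $P_{m+t(j-1),\,j}=P^{j-1,m-1}$ and $P_{m+t(j-1),\,N-j+2}=\overline{P^{j-1,m-1}}$ for $t=0,1,\dots,\frac{\mathrm{lcm}(N,j-1)}{j-1}-1$. - If $N$ is even, the $(\frac N2+1)$-th column satisfies $P_{m,\frac N2+1}=P_{m+\frac N2,\frac N2+1}=P^{\frac N2,m-1}$, $m=1,\dots,\frac N2$, with arbitrary real parameters $P^{\frac N2,m-1}$. *)

(* Defs.v *)
From HB Require Import structures.
From mathcomp Require Import all_boot all_order all_algebra.
From mathcomp Require Import complex ring.
From mathcomp Require Import all_classical all_reals all_analysis.

Set Implicit Arguments.
Unset Strict Implicit.
Unset Printing Implicit Defensive.

Import Order.TTheory GRing.Theory Num.Theory.
Import numFieldNormedType.Exports.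

Local Open Scope classical_set_scope.
Local Open Scope ring_scope.
Local Open Scope sesquilinear_scope.
Local Open Scope complex_scope.

(* Rows and columns are numbered from 0: the index i : 'I_n stands for the
   (i+1)-st row or column. *)

Section ComplexMatrices.
Context {R : realType}.

Definition cexp (z : R[i]) : R[i] :=
  (expR (complex.Re z))%:C * (cos (complex.Im z) +i* sin (complex.Im z)).

Definition EXP {m n : nat} (A : 'M[R[i]]_(m, n)) : 'M[R[i]]_(m, n) :=
  map_mx cexp A.

Definition hadamard {m n : nat} (A B : 'M[R[i]]_(m, n)) : 'M[R[i]]_(m, n) :=
  map2_mx *%R A B.

(* mxvec is row-major. *)
Definition vecR {n : nat} (A : 'M[R[i]]_n) : 'rV[R]_(n * n + n * n) :=
  row_mx (mxvec (map_mx (@complex.Re R) A)) (mxvec (map_mx (@complex.Im R) A)).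

Definition fourier (n : nat) : 'M[R[i]]_n :=
  \matrix_(i < n, j < n)
    ((Num.sqrt n%:R)^-1%:C * cexp ('i * (2 * pi / n%:R * i%:R * j%:R)%:C)).

Definition complex_hadamard {n : nat} (V : 'M[R[i]]_n) : Prop :=
  V \is unitarymx /\ forall i j, `|V i j| = (Num.sqrt n%:R)^-1%:C.

Definition dephased_wrt {n : nat} (F V : 'M[R[i]]_n) : Prop :=
  forall i j : 'I_n, i = 0%N :> nat \/ j = 0%N :> nat -> V i j = F i j.

End ComplexMatrices.

Section Defect.
Context {R : realType}.

(* The dimension of a set that is a linear subspace, see rdimE. *)
Definition rdim {V : vectType R} (S : set V) : nat :=
  \dim (xget 0%VS [set U : {vspace V} | S = [set x | x \in U]]).

Lemma rdimE (V : vectType R) (U : {vspace V}) :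
  rdim [set x | x \in U] = \dim U.
Proof.
rewrite /rdim; case: xgetP => [W _ /= UW|/(_ U)]; last by case.
congr (\dim _); apply/vspaceP => x.
have : [set x | x \in U] x = [set x | x \in W] x by rewrite UW.
by rewrite /= => e; apply/idP/idP; rewrite e.
Qed.

Definition Dsqnorm {n : nat} (U V : 'M[R[i]]_n) : 'M[R]_n :=
  \matrix_(i, j) (2 * complex.Re ((U i j)^* * V i j)).

Definition tangent_unitary {n : nat} (U : 'M[R[i]]_n) : set 'M[R[i]]_n :=
  [set E *m U | E in [set E : 'M[R[i]]_n | E ^t* = - E]].

(* Integer-valued, so that no subtraction is truncated. *)
Definition defect {n : nat} (U : 'M[R[i]]_n) : int :=
  (n%:Z - 1) ^+ 2 - (rdim (Dsqnorm U @` tangent_unitary U))%:Z.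

Lemma Dsqnorm_tangent_subspace (n : nat) (U : 'M[R[i]]_n) :
  exists W : {vspace 'M[R]_n},
    Dsqnorm U @` tangent_unitary U = [set x | x \in W].
Proof.
pose E (AB : 'M[R]_n * 'M[R]_n) : 'M[R[i]]_n :=
  \matrix_(i, j) ((AB.1 i j - AB.1 j i) +i* (AB.2 i j + AB.2 j i)).
have E_lin a x y i j : E (a *: x + y) i j = a%:C * E x i j + E y i j.
  by rewrite !mxE /=; simpc; congr (_ +i* _); ring.
pose L AB := Dsqnorm U (E AB *m U).
have L_lin : linear L.
  move=> a x y; apply/matrixP => i j; rewrite !mxE.
  have -> : \sum_k E (a *: x + y) i k * U k j =
      a%:C * (\sum_k E x i k * U k j) + \sum_k E y i k * U k j.
    rewrite mulr_sumr -big_split /=; apply: eq_bigr => k _.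
    by rewrite E_lin mulrDl mulrA.
  move: (\sum_k _) (\sum_k _) (U i j) => [a1 a2] [b1 b2] [u1 u2] /=.
  ring.
pose LL := GRing.isLinear.Build _ _ _ _ L L_lin.
pose Ll : {linear _ -> _} := HB.pack L LL.
exists (limg (linfun Ll)); apply/seteqP; split => [_ [_ [A EA <-] <-]|].
  apply/memv_imgP; pose B : 'M[R]_n * 'M[R]_n :=
    (map_mx (fun z => complex.Re z / 2) A, map_mx (fun z => complex.Im z / 2) A).
  exists B; first exact: memvf.
  rewrite lfunE /= /L; congr (Dsqnorm U (_ *m U)); apply/matrixP => i j.
  have /matrixP/(_ j i) := EA; rewrite !mxE /=.
  case: (A i j) (A j i) => [a b] [c d] [ea eb].
  by congr (_ +i* _); rewrite /= ?ea ?(oppr_inj eb); field.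
move=> v /= /memv_imgP [x _ ->]; rewrite (lfunE Ll) /=.
exists (E x *m U) => //; exists (E x) => //=.
apply/matrixP => i j; rewrite !mxE /=.
by rewrite -[LHS]/((_ -i* _)); simpc; congr (_ +i* _); ring.
Qed.

End Defect.

Section ParameterCycleMatrices.
Context {R : realType}.

(* P is the parameter cycle matrix with parameters c x y (step x, cycle y).
   The m-th cycle of the column of index x (0-based, step x) runs through the
   rows m + t x modulo n; the column of index n - x is its conjugate. *)
Definition PCM {n : nat} (c : nat -> nat -> R[i]) (P : 'M[R[i]]_n) : Prop :=
  [/\ forall i j : 'I_n, j = 0%N :> nat -> c 0%N i \is Num.real /\ P i j = c 0%N i,
      forall x m t : nat,
        (1 <= x <= (if odd n then n.-1./2 else n./2.-1))%N ->
        (m < gcdn n x)%N -> (t < lcmn n x %/ x)%N ->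
        forall i j : 'I_n, i = ((m + t * x) %% n)%N :> nat ->
          (j = x :> nat -> P i j = c x m) /\
          (j = (n - x)%N :> nat -> P i j = (c x m)^*)
    & ~~ odd n ->
        forall m : nat, (m < n./2)%N -> c n./2 m \is Num.real /\
          forall i j : 'I_n, i = m :> nat \/ i = (m + n./2)%N :> nat ->
            j = n./2 :> nat -> P i j = c n./2 m].

Definition PCM_space (p k : nat) : set 'M[R[i]]_(p ^ k) :=
  [set P | exists c : nat -> nat -> R[i],
    [/\ PCM c P,
        forall j : nat,
          (1 <= j <= (if p == 2 then (p ^ k)./2 else (p ^ k).-1./2))%N ->
          c j 0%N = 0
      & forall i : 'I_(p ^ k),
          c 0%N i = - \sum_(j < p ^ k | (0 < j)%N) P i j]].

Definition PCM_family (p k : nat) : set 'rV[R]_(p ^ k * p ^ k + p ^ k * p ^ k) :=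
  [set vecR (hadamard (fourier (p ^ k)) (EXP ('i *: (P *m fourier (p ^ k)))))
     | P in @PCM_space p k].

End ParameterCycleMatrices.

Arguments PCM_space : clear implicits.
Arguments PCM_family : clear implicits.

Section Submanifolds.
Context {R : realType}.

Fixpoint Ck_on (k : nat) {m n : nat} (O : set 'rV[R]_m)
    (f : 'rV[R]_m -> 'rV[R]_n) : Prop :=
  match k with
  | 0%N => forall u, O u -> {for u, continuous f}
  | k'.+1 => (forall u, O u -> differentiable f u) /\
      forall i : 'I_m, Ck_on k' O (fun u => 'D_(delta_mx 0 i) f u)
  end.

Definition smooth_on {m n : nat} (O : set 'rV[R]_m)
    (f : 'rV[R]_m -> 'rV[R]_n) : Prop :=
  forall k, Ck_on k O f.

(* M is covered by local parametrizations f : O -> M `&` W, which are smooth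
   immersions of an open O of R^d and homeomorphisms onto a relatively open
   part of M. *)
Definition smooth_submanifold {n : nat} (d : nat) (M : set 'rV[R]_n) : Prop :=
  forall x, M x ->
    exists (W : set 'rV[R]_n) (O : set 'rV[R]_d)
        (f : 'rV[R]_d -> 'rV[R]_n) (g : 'rV[R]_n -> 'rV[R]_d),
      [/\ open W /\ W x, open O /\ f @` O = M `&` W,
          smooth_on O f /\ (forall u, O u -> row_free ('J f u)),
          forall u, O u -> g (f u) = u
        & {within M `&` W, continuous g}].

End Submanifolds.

(* Main.v *)
(* Write w = exp(2 pi i / n) for n = p^k and let X = P F be the matrix of phases
   of a parameter cycle matrix P.  The symmetries of P make X real, and say that
   column j of X F^* is invariant under shifting the rows by j, hence under
   gcd(n, j).  This turns out to be (i) orthogonality of X to the image of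
   T_F under the differential of U |-> |U_ij|^2, and (ii) the condition that,
   for rows i = i' mod p^b, the difference of the rows i and i' of X has period
   p^(k-1-b).

   By (i), the phases vanishing on the first row and column form a space of
   dimension d(F): prescribing the first row and column on the orthogonal
   complement is possible, as matrices u_i + v_l are orthogonal to the image, and
   costs 2n - 1 dimensions.  By (ii), if p^b is the exact power of p dividing
   i - i', shifting l by T = p^(k-1-b) multiplies the terms of the inner product
   of the rows i and i' of F o EXP(iX) by w^((i-i')T) <> 1, so the rows are
   orthogonal.  The equations (ii) being integral, a solution which is close to
   2 pi M, M an integer matrix, is 2 pi M plus a small solution; hence the image
   in the torus of a small piece of the space of phases is relatively open in
   the family, with inverse given by arctangents. *)

Require Import Defs.
From HB Require Import structures.
From mathcomp Require Import all_boot all_order all_algebra.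
From mathcomp Require Import complex ring lra zify.
From mathcomp Require Import all_classical all_reals all_analysis.
Set Implicit Arguments.
Unset Strict Implicit.
Unset Printing Implicit Defensive.
Import Order.TTheory GRing.Theory Num.Theory.
Import numFieldNormedType.Exports.
Local Open Scope classical_set_scope.
Local Open Scope ring_scope.
Local Open Scope sesquilinear_scope.

(** * Orthogonality for the trace pairing of real matrices *)

Lemma mxtrace_mulmx_tr (R : comPzRingType) m n (A B : 'M[R]_(m, n)) :
  \tr (A *m B^T) = \sum_i \sum_j A i j * B i j.
Proof.
by apply: eq_bigr => i _; rewrite mxE; apply: eq_bigr => j _; rewrite mxE.
Qed.

Lemma mxtrace_mulmx_tr_eq0 (R : realDomainType) m n (A : 'M[R]_(m, n)) :
  \tr (A *m A^T) = 0 -> A = 0.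
Proof.
rewrite mxtrace_mulmx_tr => /eqP; rewrite psumr_eq0 => [/allP A0|i _];
  last first.
  by apply: sumr_ge0 => j _; rewrite -expr2 sqr_ge0.
apply/matrixP => i j; rewrite mxE; apply/eqP; rewrite -sqrf_eq0 expr2.
have /eqP/psumr_eq0P -> // := A0 i (mem_index_enum _).
by move=> k _; rewrite -expr2 sqr_ge0.
Qed.

(** The complement is the kernel of the pairings with a basis of [W]. By rank-nullity its dimension
    is right once these pairings are injective on [W], which is definiteness of [\tr (X *m X^T)]. *)
Lemma orthogonal_complement (R : realFieldType) m n
    (W : {vspace 'M[R]_(m, n)}) :
  exists2 K : {vspace 'M[R]_(m, n)}, (\dim K + \dim W = m * n)%N &
    forall X, X \in K <-> (forall Y, Y \in W -> \tr (X *m Y^T) = 0).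
Proof.
pose tau (X : 'M[R]_(m, n)) : 'rV[R]_(\dim W) :=
  \row_s \tr (X *m ((vbasis W)`_s)^T).
have tau_lin : linear tau.
  move=> a X Y; apply/rowP => s.
  by rewrite !mxE mulmxDl mxtraceD -scalemxAl mxtraceZ.
pose tauL := GRing.isLinear.Build _ _ _ _ tau tau_lin.
pose tl : {linear _ -> _} := HB.pack tau tauL.
pose f := linfun tl.
have fP X : (X \in lker f) <-> (forall Y, Y \in W -> \tr (X *m Y^T) = 0).
  rewrite memv_ker lfunE /=; split => [/eqP X0 Y|X0].
    move=> /coord_vbasis ->; rewrite raddf_sum mulmx_sumr raddf_sum.
    apply: big1 => s _; rewrite /= linearZ /= -scalemxAr mxtraceZ.
    by have /rowP/(_ s) := X0; rewrite !mxE => ->; rewrite mulr0.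
  apply/eqP/rowP => s; rewrite !mxE X0 // vbasis_mem // mem_nth //.
  by rewrite size_tuple.
exists (lker f) => //.
have : (\dim (fullv :&: lker f) + \dim (limg f) =
  \dim (@fullv _ 'M[R]_(m, n)))%N.
  exact: limg_ker_dim.
rewrite capfv dimvf /dim /= => <-; congr addn; apply/eqP.
rewrite eqn_leq; apply/andP; split; last first.
  by rewrite (leq_trans (dimvS (subvf _)))// dimvf /dim /= mul1n.
have /limg_dim_eq dW : (W :&: lker f = 0)%VS.
  apply/eqP; rewrite -subv0; apply/subvP => X /[!memv_cap] /andP[XW /fP X0].
  by rewrite memv0; apply/eqP/mxtrace_mulmx_tr_eq0/X0.
by apply: leq_trans (dimvS (limgS f (subvf W))); rewrite dW.
Qed.

(** * The defect as the dimension of a space of phases *)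

Section DefectOfUnitary.
Context {R : realType}.
Local Open Scope complex_scope.

Lemma conj_real_complex (x : R) : Num.conj (x%:C : R[i]) = x%:C.
Proof. exact: conjc_real. Qed.

(* For antihermitian [E], the trace pairing of [X] with [Dsqnorm U (E *m U)] is
   [\sum_(i, j) E i j * unitary_flux U X i j]; as the flux is itself
   antihermitian, its vanishing is orthogonality of [X] to the image of the
   tangent space. *)
Definition unitary_flux n (U : 'M[R[i]]_n) (X : 'M[R]_n) : 'M[R[i]]_n :=
  \matrix_(i, j) \sum_l (X i l - X j l)%:C * (Num.conj (U i l) * U j l).

Lemma unitary_flux_skew n (U : 'M[R[i]]_n) X :
  (unitary_flux U X)^t* = - unitary_flux U X.
Proof.
apply/matrixP => i j; rewrite !mxE rmorph_sum -sumrN; apply: eq_bigr => l _.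
rewrite !rmorphM /= conj_real_complex conjCK !rmorphB /=; ring.
Qed.

(** Write [2 Re z = z + Num.conj z]. As [E] is antihermitian, the conjugate terms, after exchanging
    [i] and [j], differ from the original ones only by a sign and by [X j l] in place of [X i l]. *)
Lemma Dsqnorm_mxtrace n (U E : 'M[R[i]]_n) (X : 'M[R]_n) :
  E ^t* = - E ->
  (\tr (X *m (Dsqnorm U (E *m U))^T))%:C
    = \sum_i \sum_j E i j * unitary_flux U X i j.
Proof.
move=> EA; rewrite mxtrace_mulmx_tr rmorph_sum /=.
pose a i l j := (X i l)%:C * (Num.conj (U i l) * (E i j * U j l)).
have EC i j : Num.conj (E i j) = - E j i.
  by have /matrixP/(_ j i) := EA; rewrite !mxE.
have aJ i l j : Num.conj (a i l j)
    = - ((X i l)%:C * (Num.conj (U j l) * (E j i * U i l))).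
  rewrite !rmorphM /= conjCK EC conj_real_complex.
  by ring.
transitivity (\sum_i \sum_l \sum_j (a i l j + Num.conj (a i l j))).
  apply: eq_bigr => i _; rewrite rmorph_sum; apply: eq_bigr => l _ /=.
  rewrite big_split /= -rmorph_sum /= !mxE.
  set z := Num.conj _ * _.
  have -> : \sum_j a i l j = (X i l)%:C * z by rewrite /a -!mulr_sumr.
  move: z => z; rewrite !rmorphM /= conj_real_complex -mulrDr; congr (_ * _).
  by rewrite -[Num.conj z]/(conjc z) addcJ rmorph_nat.
transitivity (\sum_i \sum_j \sum_l a i l j
              + \sum_i \sum_j \sum_l Num.conj (a i l j)).
  rewrite -big_split; apply: eq_bigr => i _.
  rewrite exchange_big -big_split; apply: eq_bigr => j _ /=.
  by rewrite -big_split.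
rewrite [X in _ + X]exchange_big /= -big_split /=; apply: eq_bigr => i _.
rewrite -big_split /=; apply: eq_bigr => j _;
  rewrite -big_split /= mxE mulr_sumr.
apply: eq_bigr => l _; rewrite aJ /a rmorphB /=; ring.
Qed.

(** The pairing is tested on [E = H^T], where [H] is the flux: this [E] is antihermitian, and the
    pairing becomes minus the sum of the squared moduli of the entries of [H]. *)
Lemma Dsqnorm_tangent_orthogonal n (U : 'M[R[i]]_n) (X : 'M[R]_n) :
  (forall Y, (Dsqnorm U @` tangent_unitary U) Y -> \tr (X *m Y^T) = 0) <->
  unitary_flux U X = 0.
Proof.
split=> [X0|H0 _ [_ [E EA <-] <-]]; last first.
  apply: (@complexI R); rewrite Dsqnorm_mxtrace// big1// => i _.
  by rewrite big1// => j _; rewrite H0 mxE mulr0.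
set H := unitary_flux U X.
pose E : 'M[R[i]]_n := H^T.
have EA : E ^t* = - E by rewrite -map_trmx unitary_flux_skew raddfN.
have HJ i j : H j i = - Num.conj (H i j).
  have /matrixP/(_ j i) := unitary_flux_skew U X.
  by rewrite -/H !mxE => ->; rewrite opprK.
have DE : (Dsqnorm U @` tangent_unitary U) (Dsqnorm U (E *m U)).
  by exists (E *m U) => //; exists E.
have /(congr1 (real_complex R)) := X0 _ DE.
rewrite Dsqnorm_mxtrace// -/H => /eqP; rewrite -oppr_eq0 -sumrN => /eqP HH0.
have H_ge0 i j : 0 <= - (E i j * H i j).
  by rewrite [E i j]mxE (HJ i j) mulNr opprK mulrC mul_conjC_ge0.
apply/matrixP => i j; rewrite [RHS]mxE.
suff /eqP : H i j * Num.conj (H i j) = 0 by rewrite mul_conjC_eq0 => /eqP.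
have Hi_ge0 k : 0 <= - \sum_j E k j * H k j by rewrite -sumrN sumr_ge0.
have := psumr_eq0P (fun k _ => Hi_ge0 k) HH0 (i := i) isT;
  rewrite -sumrN => Hi0.
rewrite -(psumr_eq0P (fun k _ => H_ge0 i k) Hi0 (i := j) isT).
by rewrite [E i j]mxE (HJ i j) mulNr opprK mulrC.
Qed.

Lemma defect_unitary n (U : 'M[R[i]]_n) : (0 < n)%N -> U \is unitarymx ->
  exists2 K : {vspace 'M[R]_n}, (\dim K)%:Z = defect U &
    forall X, X \in K <-> unitary_flux U X = 0 /\
      (forall i j : 'I_n, i = 0%N :> nat \/ j = 0%N :> nat -> X i j = 0).
Proof.
case: n U => // m U _ /unitarymxP UU; have [W WE] := Dsqnorm_tangent_subspace U.
have [K dK KP] := orthogonal_complement W.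
have KflP X : X \in K <-> unitary_flux U X = 0.
  by rewrite KP -Dsqnorm_tangent_orthogonal WE.
pose rho (X : 'M[R]_m.+1) : 'rV[R]_(m.+1 + m) :=
  row_mx (row ord0 X) (\row_i X (lift ord0 i) ord0).
have rho_lin : linear rho.
  move=> a X Y; rewrite /rho scale_row_mx add_row_mx; congr row_mx.
    by rewrite linearP.
  by apply/rowP => i; rewrite !mxE.
pose rhoL := GRing.isLinear.Build _ _ _ _ rho rho_lin.
pose rl : {linear _ -> _} := HB.pack rho rhoL.
pose f := linfun rl.
exists (K :&: lker f)%VS; last first.
  move=> X; rewrite memv_cap memv_ker lfunE /= /rho; split.
    move=> /andP[/KflP X0];
      rewrite -[X in _ == X]row_mx0 => /eqP/eq_row_mx[r0 c0].
    split=> // i j [i0|j0].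
      have -> : i = ord0 by apply/val_inj.
      by have /rowP/(_ j) := r0; rewrite !mxE.
    have -> : j = ord0 by apply/val_inj.
    case: (unliftP ord0 i) => [i'|] ->; first by have /rowP/(_ i') := c0;
      rewrite !mxE.
    by have /rowP/(_ ord0) := r0; rewrite !mxE.
  move=> [/KflP XK X0]; rewrite XK /= -[X in _ == X]row_mx0; apply/eqP.
  by congr row_mx; apply/rowP => i; rewrite !mxE X0//; [left|right].
have fK : (f @: K)%VS = fullv.
  apply/vspaceP => v; rewrite memvf; apply/memv_imgP.
  (* The preimage has entries [c i + v_l]: [c] vanishes at [ord0], which gives the first row, and is
     chosen to fit the first column. The flux at [(i, j)] is [c i - c j] times an inner product of
     rows of [U], which is zero for [i <> j]. *)
  pose c (i : 'I_m.+1) := if unlift ord0 i is Some i' then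
    v ord0 (rshift _ i') - v ord0 (lshift _ ord0) else 0.
  exists (\matrix_(i, l) (c i + v ord0 (lshift _ l))).
    apply/KflP/matrixP => i j; rewrite !mxE.
    transitivity (\sum_l (c i - c j)%:C * (U j l * Num.conj (U i l))).
      apply: eq_bigr => l _; rewrite !mxE [Num.conj _ * _]mulrC;
        congr (_%:C * _).
      by rewrite opprD addrACA subrr addr0.
    have /matrixP/(_ j i) := UU; rewrite -mulr_sumr !mxE.
    under eq_bigr do rewrite !mxE.
    move=> ->; have [->|] := eqVneq j i; first by rewrite subrr mul0r.
    by rewrite mulr0.
  rewrite lfunE /= /rho -[LHS]hsubmxK; congr row_mx.
    by apply/rowP => i; rewrite !mxE /c unlift_none add0r.
  by apply/rowP => i; rewrite !mxE /c liftK subrK.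
(* The size is [m.+1], and the [2 m + 1] prescribed entries account for the difference between
   [(m + 1)^2] and the [m^2] of the defect. *)
have := limg_ker_dim f K; rewrite fK dimvf /dim /= mul1n => dKf.
rewrite /defect WE rdimE;
  have : (\dim (K :&: lker f) + (m.+1 + m) + \dim W = m.+1 * m.+1)%N.
  by rewrite dKf.
move: (\dim (K :&: lker f)) (\dim W) => k w /(congr1 Posz);
  rewrite !PoszD PoszM.
by lia.
Qed.

End DefectOfUnitary.

(** * Complex numbers of modulus one, shifted sums, powers of [p] *)

Section Expi.
Context {R : realType}.
Local Open Scope complex_scope.

Definition expi (x : R) : R[i] := cos x +i* sin x.

Lemma cexp_i x : cexp ('i * x%:C) = expi x.
Proof.
rewrite /cexp /expi; simpc.
by rewrite /= ?(mul0r, mulr0, mul1r, addr0, add0r, subr0, oppr0) expR0; simpc.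
Qed.

Lemma expi0 : expi 0 = 1.
Proof. by rewrite /expi cos0 sin0. Qed.

Lemma expiD x y : expi (x + y) = expi x * expi y.
Proof. by rewrite /expi cosD sinD; simpc; rewrite [X in _ +i* X]addrC. Qed.

Lemma expiMn x n : expi (x *+ n) = expi x ^+ n.
Proof.
elim: n => [|n IHn]; first by rewrite mulr0n expi0.
by rewrite mulrS exprS expiD IHn.
Qed.

Lemma conj_expi x : Num.conj (expi x) = expi (- x).
Proof. by rewrite /expi cosN sinN. Qed.

Lemma normc_expi x : `|expi x| = 1.
Proof. by rewrite normc_def /= cos2Dsin2 sqrtr1. Qed.

Lemma expi_2pi_nat n : expi ((2 * pi) *+ n) = 1.
Proof.
rewrite expiMn (_ : expi (2 * pi) = 1) ?expr1n//.
by rewrite /expi mulr_natl cos2pi sin2pi.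
Qed.

(** The real part is [1 - 2 * sin (pi * x) ^+ 2], and this sine is positive. *)
Lemma expi_2pi_neq1 x : 0 < x < 1 -> expi (2 * pi * x) != 1.
Proof.
move=> /andP[x_gt0 x_lt1]; apply/eqP => -[c1 _].
have : 0 < sin (pi * x) ^+ 2.
  by rewrite exprn_gt0// sin_gt0_pi// mulr_gt0 ?pi_gt0//= gtr_pMr ?pi_gt0.
move: c1; rewrite -mulrA mulr_natl cos_mulr2n cos2sin2; lra.
Qed.

End Expi.

(** A cyclic shift of the summation index by [t] multiplies the sum by [z], so the sum equals [z]
    times itself. *)
Lemma sum_shift_eq0 (C : idomainType) n (D : 'I_n -> C) (t : nat) (z : C) :
  z != 1 -> (forall l l' : 'I_n, l' = l + t %[mod n] -> D l' = z * D l) ->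
  \sum_l D l = 0.
Proof.
case: n D => [|n] D z1 Dt; first by rewrite big_ord0.
have : \sum_l D l = z * \sum_l D l.
  rewrite [LHS](reindex_inj (addIr (inZp t))) mulr_sumr /=.
  by apply: eq_bigr => l _; apply: Dt; rewrite /= modnDmr modn_mod.
move=> /eqP; rewrite -subr_eq0 -{1}[\sum_l _]mul1r -mulrBl mulf_eq0 subr_eq0.
by rewrite eq_sym (negPf z1) => /eqP.
Qed.

(** Yields the exponent of the exact power of [p] dividing [i - i'], which selects the period in
    [biperiodic]. *)
Lemma eq_mod_expn_step p k i i' : i <> i' %[mod p ^ k] ->
  exists2 b, (b < k)%N &
    i = i' %[mod p ^ b] /\ i <> i' %[mod p ^ b.+1].
Proof.
elim: k => [|k IHk]; first by rewrite expn0 !modn1.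
have [ii'|/eqP/IHk[b bk ?] _] := eqVneq (i %% p ^ k)%N (i' %% p ^ k)%N.
  by exists k.
by exists b => //; rewrite ltnW.
Qed.

(** * The Fourier matrix with additional phases, and its unitarity *)

Section Fourier.
Context {R : realType} {n : nat}.
Hypothesis n_gt0 : (0 < n)%N.
Local Open Scope complex_scope.
Local Notation alpha := (Num.sqrt (n%:R : R))^-1.
Local Notation w := (expi (2 * pi / n%:R) : R[i]).
Local Notation F := (fourier n : 'M[R[i]]_n).

Lemma fourierE (i j : 'I_n) : F i j = alpha%:C * w ^+ (i * j).
Proof. by rewrite mxE cexp_i -expiMn -mulrA -natrM mulr_natr. Qed.

Lemma fourier_root_primitive : n.-primitive_root w.
Proof.
rewrite /primitive_root_of_unity n_gt0; apply/forallP => i.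
rewrite unity_rootE -expiMn -[_ / _ *+ _]mulr_natr.
rewrite -mulrA [_^-1 * _]mulrC; apply/eqP.
have n0 : 0 < n%:R :> R by rewrite ltr0n.
have [->|ni] := eqVneq i.+1 n;
  first by rewrite divff ?lt0r_neq0// mulr1 (expi_2pi_nat 1) eqxx.
apply: negbTE; apply: expi_2pi_neq1;
  rewrite divr_gt0 ?ltr0n//= ltr_pdivrMr// mul1r ltr_nat.
by rewrite ltn_neqAle ni ltn_ord.
Qed.

Lemma inv_sqrt_mul_natr : (alpha * alpha) * n%:R = 1.
Proof.
have n0 : 0 < n%:R :> R by rewrite ltr0n.
by rewrite -invfM -expr2 sqr_sqrtr ?ltW// mulVf ?gt_eqF.
Qed.

Lemma inv_sqrt_neq0 : alpha != 0.
Proof. by rewrite invr_eq0 gt_eqF// sqrtr_gt0 ltr0n. Qed.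

Lemma expr_fourier_root_conj m : w ^+ m * Num.conj (w ^+ m) = 1.
Proof. by rewrite -expiMn conj_expi -expiD subrr expi0. Qed.

Definition fourier_phase (X : 'M[R]_n) : 'M[R[i]]_n :=
  \matrix_(i, j) (F i j * expi (X i j)).

Lemma hadamard_EXP (X : 'M[R]_n) :
  hadamard F (EXP ('i *: map_mx (real_complex R) X)) = fourier_phase X.
Proof. by apply/matrixP => i j; rewrite !mxE !cexp_i. Qed.

Lemma fourier_phase0 : fourier_phase 0 = F.
Proof. by apply/matrixP => i j;
  rewrite [LHS]mxE [X in expi X]mxE expi0 mulr1. Qed.

Lemma norm_fourier_phase X i j : `|fourier_phase X i j| = alpha%:C.
Proof.
rewrite mxE fourierE !normrM -expiMn !normc_expi !mulr1.
by rewrite ger0_norm// ler0c invr_ge0 sqrtr_ge0.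
Qed.

(* These equations have integer coefficients; this is what makes the family a
   closed subset of the torus of phases, and not only an immersed one. *)
Definition biperiodic p k (X : 'M[R]_n) := forall b (i i' l l' : 'I_n),
  (b < k)%N -> i = i' %[mod p ^ b] -> l = l' %[mod p ^ (k - b.+1)] ->
  X i l - X i' l = X i l' - X i' l'.

Lemma fourier_phase_unitary p k X : n = (p ^ k)%N ->
  biperiodic p k X -> fourier_phase X \is unitarymx.
Proof.
move=> nE Xp; apply/unitarymxP/matrixP => i i'; rewrite !mxE.
have E (a b l : 'I_n) : fourier_phase X a l * (fourier_phase X)^t* l b =
    (alpha * alpha)%:C * (w ^+ (a * l) * Num.conj (w ^+ (b * l)))
      * expi (X a l - X b l).
  rewrite [_^t* _ _]mxE [_^T _ _]mxE ![fourier_phase X _ _]mxE !fourierE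
    !rmorphM /=.
  by rewrite conj_expi conj_real_complex expiD; ring.
have [<-|ii'] := eqVneq i i'.
  under eq_bigr do rewrite E expr_fourier_root_conj subrr expi0 !mulr1.
  by rewrite sumr_const card_ord -rmorphMn /= -mulr_natr inv_sqrt_mul_natr.
have /eq_mod_expn_step[b bk [ii'b ii'Sb]] : i <> i' %[mod p ^ k].
  by rewrite -nE !modn_small//; apply/eqP.
set T := (p ^ (k - b.+1))%N.
have nT : n = (p ^ b.+1 * T)%N by rewrite nE /T -expnD subnKC.
have T_gt0 : (0 < T)%N by move: n_gt0; rewrite nT muln_gt0 => /andP[].
(* The factor is [w^((i - i') T)]; it differs from 1 since [n = p^(b+1) T] and [p^(b+1)] does not
   divide [i - i']. The phase difference of the two rows has period [T]. *)
apply: (@sum_shift_eq0 _ _ _ T (w ^+ (i * T) * Num.conj (w ^+ (i' * T)))).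
  apply/eqP => /(congr1 ( *%R^~ (w ^+ (i' * T)))) /eqP; rewrite mul1r.
  rewrite -mulrA [Num.conj _ * _]mulrC expr_fourier_root_conj mulr1.
  rewrite (eq_prim_root_expr fourier_root_primitive) => iT; apply/ii'Sb/eqP.
  by rewrite -(eqn_pmul2r T_gt0) !muln_modl -nT.
move=> l l' ll'; rewrite !E.
have wl m : w ^+ (m * l') = w ^+ (m * l) * w ^+ (m * T).
  rewrite -exprD -mulnDr; apply/eqP;
    rewrite (eq_prim_root_expr fourier_root_primitive).
  by rewrite -modnMmr ll' modnMmr.
have <- : X i l - X i' l = X i l' - X i' l'.
  apply: Xp bk ii'b _; move: ll' => /(congr1 (modn^~ T)).
  have Tn : (T %| n)%N by rewrite [in X in (_ %| X)%N]nT dvdn_mull.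
  by rewrite !modn_dvdm// modnDr.
by rewrite !wl rmorphM /=; ring.
Qed.

End Fourier.

(** * The transform of the phases and its symmetries *)

Section FourierTransform.
Context {R : realType} {n : nat}.
Local Open Scope complex_scope.
Local Notation alpha := (Num.sqrt (n%:R : R))^-1.
Local Notation w := (expi (2 * pi / n%:R) : R[i]).
Local Notation F := (fourier n : 'M[R[i]]_n).

(* As [F ^t*] inverts [F], [P = fhat X] recovers [P] from the phases [X = P F]. *)
Definition fhat (X : 'M[R]_n) : 'M[R[i]]_n := map_mx (real_complex R) X *m F^t*.

(** Modulo [n], steps of length [j] link exactly the rows congruent modulo [gcdn n j]: the column is
    constant along the cycles of step [j]. *)
Definition cyclic_columns (P : 'M[R[i]]_n) := forall i i' j : 'I_n,
  i = i' %[mod gcdn n j] -> P i j = P i' j.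

(** The cases [j = j' = 0] and, for even [n], [j = j' = n / 2] make these columns real. *)
Definition conj_symmetric (P : 'M[R[i]]_n) := forall i j j' : 'I_n,
  j + j' = 0 %[mod n] -> P i j' = Num.conj (P i j).

Lemma fhatE X i j : fhat X i j = \sum_l (X i l)%:C * Num.conj (F j l).
Proof. by rewrite mxE; apply: eq_bigr => l _; rewrite !mxE. Qed.

Lemma fourier_congr (n_gt0 : (0 < n)%N) (i j a b : 'I_n) :
  (i * a)%N = (j * b)%N %[mod n] -> F i a = F j b.
Proof.
move=> ab; rewrite !fourierE; congr (_ * _).
by apply/eqP; rewrite (eq_prim_root_expr (fourier_root_primitive n_gt0));
  apply/eqP.
Qed.

Lemma conj_fourier (n_gt0 : (0 < n)%N) (j j' l : 'I_n) :
  j + j' = 0 %[mod n] -> Num.conj (F j l) = F j' l.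
Proof.
move=> jj'; have : w ^+ (j * l) * w ^+ (j' * l) = 1.
  apply/eqP; rewrite -exprD -mulnDl
    -(prim_order_dvd (fourier_root_primitive n_gt0)).
  by rewrite dvdn_mulr// /dvdn jj' mod0n.
rewrite !fourierE rmorphM /= conj_real_complex => wjj'; congr (_ * _).
by rewrite -[LHS]mulr1 -wjj' mulrA [Num.conj _ * _]mulrC expr_fourier_root_conj
  mul1r.
Qed.

Lemma fhat_conj_symmetric X : (0 < n)%N -> conj_symmetric (fhat X).
Proof.
move=> n_gt0 i j j' jj'; rewrite !fhatE rmorph_sum; apply: eq_bigr => l _ /=.
rewrite rmorphM /= conj_real_complex; congr (_ * Num.conj _).
by rewrite (conj_fourier n_gt0 _ jj').
Qed.

(** In [Num.conj (F i l) * F m l] only the difference [j] of the rows survives, which leaves [alpha]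
    times [Num.conj (F j l)]. So zero flux means that column [j] of [fhat X] is invariant under the
    shift by [j]. *)
Lemma unitary_flux_fhat X (i m j : 'I_n) : (0 < n)%N -> i = m + j %[mod n] ->
  unitary_flux F X i m = alpha%:C * (fhat X i j - fhat X m j).
Proof.
move=> n_gt0 imj; rewrite mxE !fhatE -sumrB mulr_sumr; apply: eq_bigr => l _.
have wi : w ^+ (i * l) = w ^+ (m * l) * w ^+ (j * l).
  rewrite -exprD -mulnDl; apply/eqP;
    rewrite (eq_prim_root_expr (fourier_root_primitive n_gt0)).
  by rewrite -modnMml imj modnMml.
rewrite !fourierE !rmorphM /= conj_real_complex rmorphB /= wi rmorphM.
transitivity (alpha%:C * (((X i l)%:C - (X m l)%:C)
     * (alpha%:C * (w ^+ (j * l))^*%R)) * (w ^+ (m * l) * (w ^+ (m * l))^*%R)).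
  by ring.
by rewrite expr_fourier_root_conj; ring.
Qed.

Lemma cyclic_columnsP (P : 'M[R[i]]_n) : (0 < n)%N ->
  (forall i m j : 'I_n, i = m + j %[mod n] -> P i j = P m j) ->
  cyclic_columns P.
Proof.
move=> n_gt0 Pj i i' j.
have iter t (a b : 'I_n) : a = b + t * j %[mod n] -> P a j = P b j.
  elim: t a b => [|t IHt] a b.
    by rewrite addn0 !modn_small// => /val_inj ->.
  pose c := Ordinal (ltn_pmod (b + j) n_gt0); rewrite mulSn addnA => ab.
  rewrite (IHt a c) /=; last by rewrite modnDml.
  by apply: Pj; rewrite /= modn_mod.
wlog ii' : i i' / (i' <= i)%N => [th|].
  by case/orP: (leq_total i' i) => ii' /esym e; [apply/th|apply/esym/th].
move=> /eqP; rewrite eqn_mod_dvd// => /dvdnP[s ds].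
(* Modulo [n], [a * j] is minus the gcd, so [s * a] steps of length [j] lead from [i] back to
   [i']. *)
have [a _ /dvdnP[q dq]] := Bezoutl j n_gt0.
apply/esym/(iter (s * a)%N).
rewrite -(subnKC ii') ds -addnA -mulnA -mulnDr dq mulnA addnC -modnDml.
by rewrite modnMl add0n.
Qed.

End FourierTransform.

(** * Biperiodic phases, cyclic columns and vanishing flux *)

Section BiperiodicCyclic.
Context {R : realType}.
Variables (n p k : nat).
Hypotheses (p_prime : prime p) (nE : n = (p ^ k)%N).
Local Open Scope complex_scope.
Local Notation F := (fourier n : 'M[R[i]]_n).

Let n_gt0 : (0 < n)%N.
Proof. by rewrite nE expn_gt0 prime_gt0. Qed.

Lemma fourier_unitary : F \is unitarymx.
Proof.
rewrite -fourier_phase0; apply: fourier_phase_unitary nE _ => //.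
by move=> b i i' l l' _ _ _; rewrite !mxE.
Qed.

Lemma fhatK (X : 'M[R]_n) : fhat X *m F = map_mx (real_complex R) X.
Proof. by rewrite /fhat mulmxKtV// fourier_unitary. Qed.

(** If [gcdn n j = p ^ b] with [b < k], the difference of the rows [i] and [i'] of [X] has period
    [T = p ^ (k - b.+1)], while [n] does not divide [j * T]; hence its Fourier coefficient at [j]
    vanishes. *)
Lemma biperiodic_cyclic (X : 'M[R]_n) :
  biperiodic p k X -> cyclic_columns (fhat X).
Proof.
move=> Xp i i' j; have : (gcdn n j %| p ^ k)%N by rewrite -nE dvdn_gcdl.
case/(dvdn_pfactor _ _ p_prime) => b bk gE; rewrite gE => ii'.
move: bk; rewrite leq_eqVlt => /orP[/eqP bk|bk].
  by move: ii'; rewrite bk -nE !modn_small// => /val_inj ->.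
set T := (p ^ (k - b.+1))%N.
have nT : (p ^ b.+1 * T)%N = n by rewrite nE /T -expnD subnKC.
have Tn : (T %| n)%N by rewrite -nT dvdn_mull.
have T_gt0 : (0 < T)%N by rewrite expn_gt0 prime_gt0.
apply/eqP; rewrite -subr_eq0 !fhatE -sumrB; apply/eqP.
apply: (@sum_shift_eq0 _ _ _ T (Num.conj (expi (2 * pi / n%:R) ^+ (j * T)))).
  rewrite -(rmorph1 Num.conj) (inj_eq (can_inj conjCK)).
  rewrite -(prim_order_dvd (fourier_root_primitive n_gt0)).
  apply/negP => nj; have : (p ^ b.+1 %| gcdn n j)%N.
    have pj : (p ^ b.+1 %| j)%N by rewrite -(dvdn_pmul2r T_gt0) nT.
    by rewrite dvdn_gcd pj andbT nE dvdn_exp2l.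
  by rewrite gE dvdn_Pexp2l ?prime_gt1// ltnn.
move=> l l' ll'; rewrite -!mulrBl -!rmorphB.
have <- : X i l - X i' l = X i l' - X i' l'.
  apply: Xp bk ii' _; move: ll' => /(congr1 (modn^~ T)).
  by rewrite !modn_dvdm// modnDr.
rewrite mulrCA -rmorphM; congr (_ * Num.conj _).
rewrite !fourierE mulrCA; congr (_ * _).
rewrite -exprD -mulnDr; apply/eqP;
  rewrite (eq_prim_root_expr (fourier_root_primitive n_gt0)).
by rewrite addnC -modnMmr ll' modnMmr.
Qed.

(** By Fourier inversion, column [j] contributes to the difference of the two rows only if
    [p ^ b.+1] divides [j], and then [F j l] depends only on [l] modulo [p ^ (k - b.+1)]. *)
Lemma cyclic_biperiodic (X : 'M[R]_n) :
  cyclic_columns (fhat X) -> biperiodic p k X.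
Proof.
move=> Pc b i i' l l' bk ii' ll'; apply: (@complexI R); rewrite !rmorphB /=.
have XE a c : (X a c)%:C = \sum_j fhat X a j * F j c.
  by have /matrixP/(_ a c) := fhatK X; rewrite !mxE.
rewrite !XE -!sumrB; apply: eq_bigr => j _; rewrite -!mulrBl.
have [/Pc ->|/eqP ii'j] := eqVneq (i %% gcdn n j)%N (i' %% gcdn n j)%N.
  by rewrite subrr !mul0r.
congr (_ * _); apply: fourier_congr => //.
have : (gcdn n j %| p ^ k)%N by rewrite -nE dvdn_gcdl.
case/(dvdn_pfactor _ _ p_prime) => a ak gE.
have [ab|ba] := leqP a b.
  case: ii'j; rewrite gE; move: ii' => /(congr1 (modn^~ (p ^ a)%N)).
  by rewrite !modn_dvdm// dvdn_exp2l.
have /dvdnP[s ->] : (p ^ b.+1 %| j)%N.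
  by apply: dvdn_trans (dvdn_gcdr n j); rewrite gE dvdn_exp2l.
rewrite -!mulnA -modnMmr -[RHS]modnMmr; congr ((_ * _) %% _)%N.
have := congr1 (muln (p ^ b.+1)) ll'.
by rewrite !muln_modr -expnD subnKC// -nE.
Qed.

Lemma unitary_flux_fourier (X : 'M[R]_n) :
  unitary_flux F X = 0 <-> biperiodic p k X.
Proof.
split=> [X0|Xp].
  apply/cyclic_biperiodic/cyclic_columnsP => // i m j imj.
  have /matrixP/(_ i m)/eqP := X0;
    rewrite (unitary_flux_fhat _ _ imj)// [X in _ == X]mxE mulf_eq0.
  rewrite (inj_eq (@complexI R) _ 0) (negPf (inv_sqrt_neq0 n_gt0)) /= subr_eq0.
  by move/eqP.
apply/matrixP => i m; pose j := Ordinal (ltn_pmod (i + (n - m)) n_gt0).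
have imj : i = m + j %[mod n].
  by rewrite /= modnDmr addnCA subnKC 1?ltnW// modnDr.
rewrite (unitary_flux_fhat _ _ imj)// [RHS]mxE (biperiodic_cyclic Xp (i' :=
  m)) ?subrr ?mulr0//.
have := congr1 (modn^~ (gcdn n j)) imj; rewrite !modn_dvdm ?dvdn_gcdl// => ->.
by rewrite -modnDmr (eqP (dvdn_gcdr n j)) addn0.
Qed.

End BiperiodicCyclic.

(** * Parameter cycle matrices as matrices with two symmetries *)

Section ParameterCycleMatrices.
Context {R : realType} {n : nat}.
Hypothesis n_gt0 : (0 < n)%N.
Local Open Scope complex_scope.

Lemma mod_gcd_cycle (i x : nat) :
  (0 < x)%N -> exists2 t, (t < lcmn n x %/ x)%N &
  i = (i %% gcdn n x) + t * x %[mod n].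
Proof.
move=> x_gt0; set m := (i %% gcdn n x)%N; have g_gt0 : (0 < gcdn n x)%N.
  by rewrite gcdn_gt0 n_gt0.
have [a _ /dvdnP[q dq]] := Bezoutl x n_gt0.
pose s := (i %/ gcdn n x)%N; have iE : i = (m + s * gcdn n x)%N.
  by rewrite addnC -divn_eq.
have l_gt0 : (0 < lcmn n x %/ x)%N.
  by rewrite divn_gt0// dvdn_leq ?dvdn_lcmr// lcmn_gt0 n_gt0.
(* Modulo [n], the gcd is [- a * x], and [n.-1] stands for [-1]. Reducing by the cycle length
   changes [t * x] by a multiple of [lcmn n x], hence of [n]. *)
exists ((s * a * n.-1) %% (lcmn n x %/ x))%N; first exact: ltn_pmod.
rewrite muln_modl divnK ?dvdn_lcmr// -modnDmr modn_dvdm ?dvdn_lcml// modnDmr.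
apply/eqP; rewrite -(eqn_modDr (s * a * x)).
have -> : (m + s * a * n.-1 * x + s * a * x = m + s * a * x * n)%N.
  by rewrite -{2}(prednK n_gt0) mulnS; lia.
rewrite {1}iE.
have -> : (m + s * gcdn n x + s * a * x = m + s * q * n)%N.
  by rewrite -addnA -mulnA -mulnDr dq mulnA.
by rewrite -modnDmr modnMl -[X in _ == X]modnDmr modnMl.
Qed.


Lemma PCM_column c (P : 'M[R[i]]_n) (x : nat) (i j : 'I_n) : PCM c P ->
  (0 < x <= (if odd n then n.-1./2 else n./2.-1))%N ->
  (j = x :> nat -> P i j = c x (i %% gcdn n x)%N) /\
  (j = (n - x)%N :> nat -> P i j = Num.conj (c x (i %% gcdn n x)%N)).
Proof.
move=> [_ Pcol _] xh; have /andP[x_gt0 _] := xh.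
have [t t_lt it] := mod_gcd_cycle i x_gt0.
apply: Pcol xh _ t_lt _ _ _; last by rewrite -it modn_small.
by rewrite ltn_pmod// gcdn_gt0 n_gt0.
Qed.

(** Column 0 and, for even [n], column [n./2] are fixed by [j |-> n - j] modulo [n]; the others form
    pairs with one member in the range of the complex parameters. *)
Lemma half_index_cases (j : nat) : (j < n)%N ->
  let h := (if odd n then n.-1./2 else n./2.-1) in
  [\/ j = 0%N, (0 < j <= h)%N, (0 < n - j <= h)%N | ~~ odd n /\ j = n./2].
Proof.
move=> jn h; case: (posnP j) => [->|j_gt0]; first by constructor 1.
have := odd_double_half n; rewrite -muln2 => nE.
have [jh|hj] := leqP j h; first by constructor 2.
case: (eqVneq (n - j)%N j) => [nj|nj].
  by constructor 4; move: nE; case: odd => /=; lia.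
constructor 3; rewrite subn_gt0 jn /= /h; rewrite /h in hj.
by move: hj nE; case: odd => /=; rewrite ?add1n ?add0n; lia.
Qed.

(** Together with the converse [cyclic_conj_PCM], this replaces the existence of parameters by
    symmetries that can be followed through the Fourier transform. *)
Lemma PCM_cyclic_conj c (P : 'M[R[i]]_n) :
  PCM c P -> cyclic_columns P /\ conj_symmetric P.
Proof.
move=> Pc; have [P0 _ Ph] := Pc; split.
  move=> i i' j ii';
    have [j0|jh|jh|[n_even jh]] := half_index_cases (ltn_ord j).
  - by move: ii'; rewrite j0 gcdn0 !modn_small// => /val_inj ->.
  - by rewrite !(PCM_column _ _ Pc jh).1// ii'.
  - have jE : j = (n - (n - j))%N :> nat by rewrite subKn// ltnW.
    rewrite !(PCM_column _ _ Pc jh).2//.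
    suff -> : gcdn n (n - j) = gcdn n j by rewrite ii'.
    apply/eqP; rewrite eqn_dvd !dvdn_gcd !dvdn_gcdl /= {2}jE.
    by rewrite !(dvdn_sub (dvdn_gcdl _ _) (dvdn_gcdr _ _)).
  have nE : (n./2 + n./2 = n)%N by rewrite addnn halfK (negPf n_even) subn0.
  have h_gt0 : (0 < n./2)%N by lia.
  have g : gcdn n j = n./2 by rewrite jh -{1}nE gcdnC gcdnDl gcdnn.
  move: ii'; rewrite g => ii'.
  have cols (a : 'I_n) : P a j = c n./2 (a %% n./2)%N.
    apply: (Ph n_even (a %% n./2)%N (ltn_pmod _ h_gt0)).2 => //.
    have := ltn_ord a; have [ah _|ha an] := ltnP a n./2.
      by left; rewrite modn_small.
    right; rewrite -{2}(subnK ha) modnDr modn_small ?subnK//; lia.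
  by rewrite !cols ii'.
move=> i j j'; rewrite mod0n => jj'; have jn := ltn_ord j;
  have jn' := ltn_ord j'.
have jj'E : (j + j' = 0 \/ j + j' = n)%N.
  have /dvdnP[[|[|q]]] : (n %| j + j')%N by rewrite /dvdn jj'.
  - by left.
  - by rewrite mul1n; right.
  - by rewrite !mulSn; lia.
have [j0|jh|jh|[n_even jh]] := half_index_cases jn.
- have := (P0 i j j0).1; rewrite CrealE => /eqP cr.
  have j'0 : j' = 0%N :> nat by lia.
  by rewrite (P0 i j j0).2 (P0 i j' j'0).2 cr.
- have /andP[j_gt0 _] := jh.
  rewrite (PCM_column i j Pc jh).1// (PCM_column i j' Pc jh).2//; lia.
- have j_gt0 : (0 < j)%N by case/andP: jh => _; case: odd; lia.
  rewrite (PCM_column i j Pc jh).2; last by lia.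
  by rewrite (PCM_column i j' Pc jh).1 ?conjCK//; lia.
have nE : (n./2 + n./2 = n)%N by rewrite addnn halfK (negPf n_even) subn0.
have j'h : j' = n./2 :> nat by lia.
have [m mh im] :
  exists2 m, (m < n./2)%N & i = m :> nat \/ i = (m + n./2)%N :> nat.
  have := ltn_ord i; have [ih|ih] := ltnP i n./2; first by exists i => //; left.
  by exists (i - n./2)%N; [lia|right; lia].
have [cr cP] := Ph n_even m mh; move: cr; rewrite CrealE => /eqP cr.
by rewrite !cP.
Qed.

(** Each parameter is read off in the starting row of its cycle; [o] turns natural numbers into
    indices. *)
Lemma cyclic_conj_PCM (P : 'M[R[i]]_n) : cyclic_columns P -> conj_symmetric P ->
  let o m := Ordinal (ltn_pmod m n_gt0) in PCM (fun x m => P (o m) (o x)) P.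
Proof.
move=> Pc Pconj o.
have oE (j : 'I_n) : o j = j by apply/val_inj; rewrite /= modn_small.
split=> [i j j0|x m t xh mg tl i j im|n_even m mh].
- have -> : o 0%N = j by rewrite -j0 oE.
  rewrite oE; split => //; rewrite CrealE; apply/eqP/esym/Pconj.
  by rewrite j0.
- have xn : (x < n)%N by move: xh; case: odd; lia.
  have iE (j' : 'I_n) : j' = x :> nat -> P i j' = P (o m) (o x).
    move=> j'x; rewrite -j'x oE; apply: Pc;
      rewrite im /= !modn_dvdm ?dvdn_gcdl//.
    by rewrite -modnDmr -modnMmr -j'x (eqP (dvdn_gcdr _ _)) muln0 mod0n addn0.
  split=> [/iE//|jx]; rewrite -(iE (o x)) /= ?modn_small//.
  by apply: Pconj; rewrite /= jx (modn_small xn) subnKC 1?ltnW// modnn mod0n.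
have nE : (n./2 + n./2 = n)%N by rewrite addnn halfK (negPf n_even) subn0.
have hE : o n./2 = n./2 :> nat by rewrite /= modn_small; lia.
split=> [|i j im jh].
  by rewrite CrealE; apply/eqP/esym/Pconj; rewrite hE nE modnn mod0n.
have -> : j = o n./2 by apply/val_inj/(etrans jh (esym hE)).
have g : gcdn n n./2 = n./2 by rewrite -{1}nE gcdnC gcdnDl gcdnn.
apply: Pc; rewrite hE g /= (modn_small (m := m)); last by lia.
by case: im => ->; rewrite ?modnDr.
Qed.

(** In each entry of the product, conjugation exchanges the terms of indices [j] and [- j] modulo
    [n]. *)
Lemma conj_symmetric_real (P : 'M[R[i]]_n) : conj_symmetric P ->
  exists X, map_mx (real_complex R) X = P *m fourier n.
Proof.
move=> Pconj; exists (map_mx (@complex.Re R) (P *m fourier n)).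
apply/matrixP => i l; rewrite !mxE; apply: RRe_real; rewrite CrealE.
pose neg (j : 'I_n) := Ordinal (ltn_pmod (n - j) n_gt0).
have negP (j : 'I_n) : j + neg j = 0 %[mod n].
  by rewrite /= modnDmr subnKC 1?ltnW// modnn mod0n.
have negK : involutive neg.
  move=> j; apply/val_inj => /=; have [->|j_gt0] := posnP j.
    by rewrite subn0 modnn subn0 modnn.
  by rewrite (modn_small (m := n - j)) ?subKn ?modn_small//;
    have := ltn_ord j; lia.
rewrite rmorph_sum [X in _ == X](reindex_inj (inv_inj negK)); apply/eqP.
apply: eq_bigr => j _; rewrite rmorphM /= -(Pconj i j (neg j)) ?negP//.
by rewrite (conj_fourier n_gt0 _ (negP j)).
Qed.

End ParameterCycleMatrices.

(** * The parameter space in terms of phases *)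

Section PCMSpace.
Context {R : realType}.
Variables (p k : nat).
Hypotheses (p_prime : prime p) (k_gt0 : (1 <= k)%N).
Local Open Scope complex_scope.
Local Notation n := (p ^ k)%N.
Local Notation F := (fourier n : 'M[R[i]]_n).

Let n_gt0 : (0 < n)%N.
Proof. by rewrite expn_gt0 prime_gt0. Qed.

Let ord0n : 'I_n := Ordinal n_gt0.

Let odd_n : odd n = (p != 2).
Proof.
rewrite oddX eqn0Ngt k_gt0 /=.
by case: (even_prime p_prime) => [->//|p_odd]; case: eqP p_odd => // ->.
Qed.

(** Cycle 0 of each column passes through the first row, so the vanishing of the [c j 0] kills that
    row beyond its first entry; the row sum condition then kills this entry too. *)
Lemma PCM_space_cyclic (P : 'M[R[i]]_n) : PCM_space R p k P <->
  [/\ cyclic_columns P, conj_symmetric P, forall j, P ord0n j = 0 &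
    forall i, \sum_j P i j = 0].
Proof.
have sumE i (Q : 'M[R[i]]_n) :
    \sum_j Q i j = Q i ord0n + \sum_(j < n | (0 < j)%N) Q i j.
  by rewrite (bigD1 ord0n)//; congr (_ + _); apply: eq_bigl => j; rewrite lt0n.
split=> [[c [Pc c0 crow]]|[Pcyc Pconj Prow Psum]].
  have [Pcyc Pconj] := PCM_cyclic_conj n_gt0 Pc; have [P0 _ Ph] := Pc.
  have Pj0 (j : 'I_n) : (0 < j)%N -> P ord0n j = 0.
    move=> j_gt0; have jn := ltn_ord j.
    have [j0|jh|jh|[n_even jh]] := half_index_cases n_gt0 jn.
    - by rewrite j0 in j_gt0.
    - rewrite (PCM_column n_gt0 ord0n j Pc jh).1// mod0n c0//.
      by move: jh; rewrite odd_n; case: eqP => _ /=; lia.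
    - rewrite (PCM_column n_gt0 ord0n j Pc jh).2; last by rewrite subKn// ltnW.
      rewrite mod0n c0 ?rmorph0//.
      by move: jh; rewrite odd_n; case: eqP => _ /=; lia.
    have h_gt0 : (0 < n./2)%N by lia.
    rewrite ((Ph n_even 0%N h_gt0).2 ord0n j)//; last by left.
    by rewrite c0// h_gt0; move: n_even; rewrite odd_n negbK => ->/=.
  have Psum i : \sum_j P i j = 0.
    by rewrite sumE (P0 i ord0n erefl).2 crow addNr.
  split=> // j; have [j0|/Pj0//] := posnP j.
  by rewrite (P0 ord0n j j0).2 (crow ord0n) big1 ?oppr0.
have Pc := cyclic_conj_PCM n_gt0 Pcyc Pconj; eexists; split; first exact: Pc.
  by move=> j _ /=; rewrite -[RHS](Prow (Ordinal (ltn_pmod j n_gt0)));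
    congr (P _ _);
    apply/val_inj; rewrite /= mod0n.
move=> i /=; apply/eqP; rewrite -addr_eq0 -[X in _ == X](Psum i) sumE.
by apply/eqP; congr (P _ _ + _); apply/val_inj; rewrite /= ?mod0n// modn_small.
Qed.

(** The first column of [F] is constant, so the first column of [X] is a nonzero multiple of the row
    sums of [P]; the first rows of [P] and [X] vanish together. *)
Lemma PCM_spaceP (P : 'M[R[i]]_n) : PCM_space R p k P <->
  exists X : 'M[R]_n, [/\ biperiodic p k X,
    forall i j : 'I_n, i = 0%N :> nat \/ j = 0%N :> nat -> X i j = 0 &
    P = fhat X].
Proof.
have Fi0 (j : 'I_n) : F j ord0n = F ord0n ord0n.
  by rewrite !fourierE muln0.
rewrite PCM_space_cyclic; split=> [[Pcyc Pconj Prow Psum]|[X [Xp X0 ->]]].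
  have [X XE] := conj_symmetric_real n_gt0 Pconj.
  have PE : P = fhat X by rewrite /fhat XE mulmxtVK//
    (fourier_unitary p_prime erefl).
  exists X; split=> //; first by apply: (cyclic_biperiodic p_prime erefl);
    rewrite -PE.
  move=> i j ij; apply: (@complexI R).
  have -> : (X i j)%:C = \sum_l P i l * F l j.
    by have /matrixP/(_ i j) := XE; rewrite !mxE.
  case: ij => [i0|j0].
    have -> : i = ord0n by apply/val_inj.
    by apply: big1 => l _; rewrite Prow mul0r.
  have -> : j = ord0n by apply/val_inj.
  by under eq_bigr do rewrite Fi0; rewrite -mulr_suml Psum mul0r.
split.
- exact: (biperiodic_cyclic p_prime erefl).
- exact: fhat_conj_symmetric.
- move=> j; rewrite fhatE; apply: big1 => l _; rewrite X0 ?mul0r//; by left.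
move=> i; have /matrixP/(_ i ord0n) := fhatK p_prime erefl X.
rewrite !mxE X0; last by right.
under eq_bigr do rewrite Fi0; rewrite -mulr_suml => /eqP.
rewrite mulf_eq0 => /orP[/eqP//|].
rewrite fourierE mul0n mulr1 (inj_eq (@complexI R) _ 0).
by rewrite (negPf (inv_sqrt_neq0 n_gt0)).
Qed.

End PCMSpace.

(** * Smoothness of trigonometric maps *)

Section DifferentiableRow.
Context {R : realType} {V : normedModType R}.

Lemma differentiable_row n (f : V -> 'rV[R]_n) (x : V) :
  (forall s, differentiable (fun y => f y 0 s : R) x) -> differentiable f x.
Proof.
move=> fs.
have -> : f = \sum_(s < n) (fun y => f y 0 s *: 'e_s : 'rV[R]_n).
  by apply/funext => y; rewrite fct_sumE; exact: row_sum_delta.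
by apply: differentiable_sum => s; exact: differentiableZl.
Qed.

Lemma differentiable_mulmx n q (f : V -> 'rV[R]_n) (B : 'M[R]_(n, q)) s (x :
  V) :
  differentiable f x -> differentiable (fun y => (f y *m B) 0 s : R) x.
Proof.
move=> df.
have -> : (fun y => (f y *m B) 0 s :
  R) = \sum_(i < n) (fun y => f y 0 i * B i s).
  by apply/funext => y; rewrite fct_sumE mxE.
apply: differentiable_sum => i; apply: differentiableM => //.
have := differentiable_comp df (differentiable_coord (f x) 0 i).
exact.
Qed.

End DifferentiableRow.

Section Trigonometric.
Context {R : realType} {d q : nat}.

(** The phase shift [c] makes this class contain sines and cosines and be closed under directional
    derivatives, as [- sin t = cos (t + pi / 2)]; smoothness follows by induction on the order. *)
Definition trig (B : 'M[R]_(d, q)) (a c : 'rV[R]_q) (u : 'rV[R]_d) : 'rV[R]_q :=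
  \row_s (a 0 s * cos ((u *m B) 0 s + c 0 s)).

Lemma differentiable_trig B a c u : differentiable (trig B a c) u.
Proof.
apply: differentiable_row => s.
have -> : (fun y => trig B a c y 0 s) =
    (fun y => a 0 s * (cos \o (fun y => (y *m B) 0 s + c 0 s)) y).
  by apply/funext => y; rewrite mxE.
apply: differentiableM; first exact: differentiable_cst.
apply: differentiable_comp.
  apply: differentiableD; last exact: differentiable_cst.
  exact: differentiable_mulmx.
exact/derivable1_diffP/derivable_cos.
Qed.

Lemma derive_trig B a c u v : 'D_v (trig B a c) u =
  trig B (\row_s (a 0 s * (v *m B) 0 s)) (c + const_mx (pi / 2)) u.
Proof.
rewrite derive_mx; last exact/diff_derivable/differentiable_trig.
apply/matrixP => i s; rewrite ord1 [LHS]mxE [RHS]mxE ![(\row__ _) _ _]mxE.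
rewrite [(c + _) _ _]mxE [const_mx _ _ _]mxE addrA cosDpihalf.
pose t : R -> R := fun h => (u *m B) 0 s + c 0 s + h * (v *m B) 0 s.
transitivity ('D_1 (fun h => a 0 s * cos (t h)) 0).
  rewrite /derive; apply: (congr1 (fun f : R -> R => lim (f h @[h --> 0^'])));
    apply/funext => h /=; congr (_ *: _).
  rewrite ![trig _ _ _ _ _ _]mxE /t addr0 mul0r addr0 mulmxDl -scalemxAl.
  rewrite [(_ + u *m B) _ _]mxE [(h *: (v *m B)) _ _]mxE.
  by rewrite [h *: 1]mulr1 [X in cos (X + _)]addrC addrAC.
have dt : is_derive (0 : R) 1 t ((v *m B) 0 s).
  have -> : t = cst ((u *m B) 0 s + c 0 s) + (v *m B) 0 s \*: id.
    by apply/funext => h; rewrite /t /= mulrC.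
  have := is_deriveD (is_derive_cst ((u *m B) 0 s + c 0 s) (0 : R) 1)
    (is_deriveZ ((v *m B) 0 s) (is_derive_id (0 : R) 1)).
  by rewrite add0r [_ *: 1]mulr1.
have := is_derive1_comp (is_derive_cos (t 0)) dt.
move=> /(is_deriveZ (a 0 s)) dc.
rewrite [LHS](@derive_val _ _ _ _ _ _ _ dc).
rewrite /t mul0r addr0 /GRing.scale /=; ring.
Qed.

Lemma smooth_on_trig O B a c : smooth_on O (trig B a c).
Proof.
move=> k; elim: k a c => [|k IHk] a c /= => [u _|].
  exact/differentiable_continuous/differentiable_trig.
split=> [u _|i]; first exact: differentiable_trig.
by under eq_fun do rewrite derive_trig.
Qed.

End Trigonometric.

(** * Angles modulo [2 * pi] *)

Section Angles.
Context {R : realType}.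

Lemma cos_sin_D2piz (x : R) (m : int) :
  cos (x + 2 * pi * m%:~R) = cos x /\ sin (x + 2 * pi * m%:~R) = sin x.
Proof.
have Dn (y : R) (j : nat) : cos (y + 2 * pi * j%:R) = cos y /\
    sin (y + 2 * pi * j%:R) = sin y.
  rewrite mulr_natr mulr_natl.
  by split; [exact: periodicn (@cosD2pi R) _ _|exact: periodicn (@sinD2pi R) _
    _].
case: m => j; first exact: Dn.
by rewrite NegzE mulrNz mulrN; have [<- <-] := Dn (x - 2 * pi * j.+1%:R) j.+1;
  rewrite subrK.
Qed.

Lemma cos_gt0_angle (x : R) : 0 < cos x ->
  exists m : int, `|x - 2 * pi * m%:~R| < pi / 2.
Proof.
have pi0 := pi_gt0 R => cx.
(* This is the integer nearest to [x / (2 * pi)]: the remainder is at most [pi] in absolute value,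
   and on that range a positive cosine forces it below [pi / 2]. *)
pose m := Num.floor (x / (2 * pi) + 1 / 2); exists m.
have [] := cos_sin_D2piz (x - 2 * pi * m%:~R) m; rewrite subrK => cm _.
set y := x - _ in cm *; rewrite ltNge; apply/negP => yh.
have y_pi : `|y| <= pi.
  have /andP[m1 m2] := floor_itv (x / (2 * pi) + 1 / 2).
  have yE : y = (x / (2 * pi) - m%:~R) * (2 * pi) by rewrite /y; field; lra.
  rewrite intrD in m2; rewrite ler_norml yE -/m in m1 m2 *.
  move: (x / (2 * pi)) m1 m2 => z m1 m2; apply/andP; split; nra.
suff : cos y <= 0 by rewrite -cm leNgt cx.
have -> : cos y = cos `|y| by case: ger0P => // _; rewrite cosN.
rewrite -(cos_pihalf R) leNgt ltr_cos ?in_itv /= ?normr_ge0 ?y_pi//; last lra.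
by rewrite -leNgt.
Qed.

End Angles.

Lemma open_forall_gt0 {R : realType} {T : topologicalType} (I : finType)
    (h : I -> T -> R) :
  (forall i, continuous (h i)) -> open [set x | forall i, 0 < h i x].
Proof.
move=> hc; rewrite openE => x /= hx; apply: filter_forall => i.
exact: cvgr_gt (hc i x) _ (hx i).
Qed.

(** * Images of linear subspaces in a torus *)

Section Torus.
Context {R : realType} {q : nat}.

(** Cosines precede sines as in [vecR]; [theta] holds the angles of the base point and [x] the added
    phases. *)
Definition torus (a : R) (theta x : 'rV[R]_q) : 'rV[R]_(q + q) :=
  row_mx (\row_s (a * cos (x 0 s + theta 0 s)))
         (\row_s (a * sin (x 0 s + theta 0 s))).

Lemma row_basis (S : {vspace 'rV[R]_q}) :
  exists2 B : 'M[R]_(\dim S, q), row_free B &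
    forall x, x \in S <-> exists u, x = u *m B.
Proof.
pose B := \matrix_(i < \dim S) (vbasis S)`_i.
have uB u : u *m B = \sum_i u 0 i *: (vbasis S)`_i.
  by rewrite mulmx_sum_row; apply: eq_bigr => i _; rewrite rowK.
exists B.
  rewrite -kermx_eq0; apply/rowV0P => v /sub_kermxP; rewrite uB => v0.
  have /freeP/(_ (v 0) v0) v00 := basis_free (vbasisP S).
  by apply/rowP => i; rewrite v00 mxE.
move=> x; split=> [/coord_vbasis xE|[u ->]].
  exists (\row_i coord (vbasis S) i x).
  by rewrite {1}xE uB; apply: eq_bigr => i _; rewrite mxE.
by rewrite uB; apply: memv_suml => i _;
  rewrite memvZ// vbasis_mem// mem_nth// size_tuple.
Qed.

Lemma torusEl a theta x s :
  torus a theta x 0 (lshift q s) = a * cos (x 0 s + theta 0 s).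
Proof. by rewrite row_mxEl mxE. Qed.

Lemma torusEr a theta x s :
  torus a theta x 0 (rshift q s) = a * sin (x 0 s + theta 0 s).
Proof. by rewrite row_mxEr mxE. Qed.

Lemma torus_trig d (B : 'M[R]_(d, q)) a theta x u :
  torus a theta (x + u *m B) =
  trig (row_mx B B) (const_mx a)
    (row_mx (x + theta) (x + theta - const_mx (pi / 2))) u.
Proof.
apply/rowP => s; rewrite [RHS]mxE mul_mx_row [const_mx _ _ _]mxE.
rewrite -[s]fintype.splitK; case: (fintype.split s) => s' /=.
  rewrite torusEl !row_mxEl [(x + _) _ _]mxE [(x + _) _ _]mxE;
    congr (_ * cos _).
  by ring.
rewrite torusEr !row_mxEr [(x + _) _ _]mxE -cosBpihalf; congr (_ * cos _).
have -> : (x + theta - const_mx (pi / 2)) 0 s' = x 0 s' + theta 0 s' - pi / 2.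
  by rewrite !mxE.
by ring.
Qed.

(** In direction [v], the two coordinates of index [s] have derivative [a * (v *m B) 0 s] times
    [(- sin t, cos t)], and sine and cosine do not vanish together. *)
Lemma jacobian_torus_row_free d (B : 'M[R]_(d, q)) a theta x u :
  a != 0 -> row_free B ->
  row_free ('J (fun u => torus a theta (x + u *m B)) u).
Proof.
move=> a0 Bfree; rewrite -kermx_eq0; apply/rowV0P => v /sub_kermxP.
have -> : (fun u => torus a theta (x + u *m B)) =
    trig (row_mx B B) (const_mx a)
      (row_mx (x + theta) (x + theta - const_mx (pi / 2))).
  by apply/funext => w; rewrite torus_trig.
rewrite -deriveEjacobian; last exact: differentiable_trig.
rewrite derive_trig => /rowP v0.
suff vB0 : v *m B = 0 by apply: (row_free_inj Bfree); rewrite vB0 mul0mx.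
apply/rowP => s; rewrite [RHS]mxE; apply/eqP.
have vs (y : R) : a * (v *m B) 0 s * y = 0 -> (v *m B) 0 s = 0 \/ y = 0.
  move/eqP; rewrite !mulf_eq0 (negPf a0) /=.
  by case/orP => /eqP ->; [left|right].
have [t tE] : exists t, t = (u *m B) 0 s + (x + theta) 0 s by eexists.
have := v0 (rshift q s); have := v0 (lshift q s).
rewrite [LHS]mxE [RHS]mxE => l0; rewrite [LHS]mxE [RHS]mxE; move: l0.
rewrite ![(\row__ _) _ _]mxE !mul_mx_row.
rewrite ![(row_mx _ _ + _) _ _]mxE ![const_mx _ _ _]mxE !row_mxEl !row_mxEr.
have -> : (x + theta - const_mx (pi / 2)) 0 s = (x + theta) 0 s - pi / 2.
  by rewrite !mxE.
rewrite subrK -tE addrA -tE cosDpihalf.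
move=> /vs[->//|/eqP]; rewrite oppr_eq0 => /eqP st0 /vs[->//|ct0].
by have := cos2Dsin2 t; rewrite st0 ct0 expr0n addr0 => /esym/eqP;
  rewrite oner_eq0.
Qed.

(* The rounding hypothesis says that [S] meets a neighbourhood of the lattice
   [2 pi Z^q] only in a neighbourhood of [S `&` 2 pi Z^q]; without it the image
   could wind densely around the torus. *)
Lemma torus_submanifold (S : {vspace 'rV[R]_q}) (a : R) (theta : 'rV[R]_q) :
  0 < a ->
  (forall x e : 'rV[R]_q, x \in S -> (forall s, `|e 0 s| < pi / 2) ->
    (forall s, exists m : int, x 0 s = e 0 s + 2 * pi * m%:~R) -> e \in S) ->
  smooth_submanifold (\dim S) [set torus a theta x | x in [set x | x \in S]].
Proof.
move=> a_gt0 Srat _ [x xS <-].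
have [B Bfree SB] := row_basis S; have /row_freeP[B' BB'] := Bfree.
pose c s := x 0 s + theta 0 s.
(* Real and imaginary parts after rotation by [- c s], which gives the base point angle 0. *)
pose re (y : 'rV[R]_(q + q)) s :=
  y 0 (lshift q s) * cos (c s) + y 0 (rshift q s) * sin (c s).
pose im (y : 'rV[R]_(q + q)) s :=
  y 0 (rshift q s) * cos (c s) - y 0 (lshift q s) * sin (c s).
have reE z s : re (torus a theta z) s = a * cos (z 0 s - x 0 s).
  rewrite /re torusEl torusEr (_ : z 0 s - x 0 s = z 0 s + theta 0 s - c s).
    by rewrite cosB; ring.
  by rewrite /c; ring.
have imE z s : im (torus a theta z) s = a * sin (z 0 s - x 0 s).
  rewrite /im torusEl torusEr (_ : z 0 s - x 0 s = z 0 s + theta 0 s - c s).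
    by rewrite sinB; ring.
  by rewrite /c; ring.
have coord_diff s (y : 'rV[R]_(q + q)) : differentiable (fun y :
  'rV[R]_(q + q) => y 0 s : R) y.
  exact: differentiable_coord.
have re_diff s (y : 'rV[R]_(q + q)) : differentiable (re^~ s) y.
  by apply: differentiableD; apply: differentiableM.
have im_diff s (y : 'rV[R]_(q + q)) : differentiable (im^~ s) y.
  by apply: differentiableB; apply: differentiableM.
(* On [W] the rotated coordinates lie in the right half plane, where the arctangent of [im / re] is
   the angle; [O] is the matching range of angles. *)
pose W := [set y | forall s, 0 < re y s].
pose O := [set u : 'rV[R]_(\dim S) | forall s, 0 < pi / 2 - `|(u *m B) 0 s|].
pose f (u : 'rV[R]_(\dim S)) := torus a theta (x + u *m B).
pose arg (y : 'rV[R]_(q + q)) : 'rV[R]_q := \row_s atan (im y s / re y s).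
have subx u s : (x + u *m B) 0 s - x 0 s = (u *m B) 0 s.
  by rewrite [(x + _) _ _]mxE addrAC subrr add0r.
have OP u s : O u -> - (pi / 2) < (u *m B) 0 s < pi / 2.
  by move=> /(_ s); rewrite subr_gt0 ltr_norml.
exists W, O, f, (fun y => arg y *m B'); split.
- split; last by move=> s; rewrite reE subrr cos0 mulr1.
  by apply: (open_forall_gt0 (h := fun s => re^~ s)) => s y;
    exact/differentiable_continuous.
- split.
    apply: (open_forall_gt0 (h := fun s (u : 'rV[R]_(\dim S)) => pi / 2 - `|(u *m B) 0 s|)) => s u.
    have uBs : {for u, continuous (fun u : 'rV[R]_(\dim S) => (u *m B) 0 s : R)}.
      exact/differentiable_continuous/differentiable_mulmx.
    exact: (cvgB (cvg_cst (pi / 2)) (cvg_norm uBs)).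
  apply/seteqP; split=> [_ [u Ou <-]|y [[z zS <-]] Wz].
    split; last by move=> s; rewrite reE subx mulr_gt0// cos_gt0_pihalf// OP.
    by exists (x + u *m B) => //=; apply: rpredD => //; apply/SB; exists u.
  (* The point may come from a [z] far from [x]. Rounding [z - x] modulo [2 * pi] gives a small [e],
     in [S] by the rounding hypothesis, such that [x + e] has the same image as [z]. *)
  have /choice[m mP] s : exists m :
    int, `|(z - x) 0 s - 2 * pi * m%:~R| < pi / 2.
    apply: cos_gt0_angle; have := Wz s.
    by rewrite reE pmulr_rgt0// !mxE.
  pose e : 'rV[R]_q := \row_s ((z - x) 0 s - 2 * pi * (m s)%:~R).
  have /SB[u eE] : e \in S.
    apply: (Srat (z - x)) => [|s|s]; first exact: rpredB.
      by rewrite mxE.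
    by exists (m s); rewrite [e _ _]mxE subrK.
  exists u; first by move=> s; rewrite -eE subr_gt0 mxE.
  have zE s : x 0 s + e 0 s + theta 0 s + 2 * pi * (m s)%:~R =
    z 0 s + theta 0 s.
    by rewrite !mxE; ring.
  rewrite /f -eE; congr row_mx; apply/rowP => s; rewrite !mxE.
    by rewrite -(cos_sin_D2piz _ (m s)).1 -[LHS]/(a * cos _);
      congr (_ * cos _); ring.
  by rewrite -(cos_sin_D2piz _ (m s)).2; congr (_ * sin _); ring.
- split=> [|u _]; last by apply: jacobian_torus_row_free => //; rewrite gt_eqF.
  have -> : f = trig (row_mx B B) (const_mx a)
      (row_mx (x + theta) (x + theta - const_mx (pi / 2))).
    by apply/funext => u; rewrite /f torus_trig.
  exact: smooth_on_trig.
- move=> u Ou; rewrite -[RHS]mulmx1 -BB' mulmxA; congr (_ *m _).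
  apply/rowP => s; rewrite mxE imE reE subx -mulf_div divff ?gt_eqF// mul1r.
  by rewrite tanK// in_itv/= OP.
apply: continuous_in_subspaceT => y /[!inE] -[_ Wy].
apply: differentiable_continuous; apply: differentiable_row => s.
apply: differentiable_mulmx; apply: differentiable_row => s'.
have -> : (fun y => arg y 0 s') = atan \o (fun y => im y s' / re y s').
  by apply/funext => y'; rewrite mxE.
apply: differentiable_comp.
  apply: differentiableM => //; apply: differentiableV => //.
  by rewrite gt_eqF.
exact/derivable1_diffP/derivable_atan.
Qed.

End Torus.

(** * Rounding phases to multiples of [2 * pi] *)

Lemma small_multiple_2pi_eq0 {R : realType} (e : R) (m : int) :
  `|e| < 2 * pi -> e + 2 * pi * m%:~R = 0 -> e = 0.
Proof.
have pi0 := pi_gt0 R => e_lt em0.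
suff m0 : m = 0 by move: em0; rewrite m0 mulr0 addr0.
have : `|m%:~R| < 1 :> R.
  have -> : m%:~R = - e / (2 * pi).
    by apply: (mulIf (x := 2 * pi)); [lra|rewrite divfK; lra].
  rewrite normrM normrN normfV (gtr0_norm (x := 2 * pi)); last by lra.
  by rewrite ltr_pdivrMr ?mul1r//; lra.
by rewrite -intr_norm ltrz1; lia.
Qed.

(** Each equation has four entries with coefficients 1 or -1. For [E] its two sides differ by less
    than [4 * (pi / 2) = 2 * pi] and by a multiple of [2 * pi], hence not at all. *)
Lemma biperiodic_round {R : realType} (n p k : nat) (X E : 'M[R]_n) :
  biperiodic p k X -> (forall i j, `|E i j| < pi / 2) ->
  (forall i j, exists m : int, X i j = E i j + 2 * pi * m%:~R) ->
  biperiodic p k E.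
Proof.
move=> Xp Elt XE b i i' l l' bk ii' ll'.
have := Xp b i i' l l' bk ii' ll'.
have [m1 ->] := XE i l; have [m2 ->] := XE i' l.
have [m3 ->] := XE i l'; have [m4 ->] := XE i' l' => e.
have E0 : E i l - E i' l - (E i l' - E i' l') = 0.
  apply: (small_multiple_2pi_eq0 (m := m1 - m2 - m3 + m4)).
    have := Elt i' l'; have := Elt i l'; have := Elt i' l; have := Elt i l.
    rewrite !ltr_norml => /andP[? ?] /andP[? ?] /andP[? ?] /andP[? ?].
    by apply/andP; split; lra.
  by rewrite !(intrD, intrB); lra.
by lra.
Qed.

(** * The family as the image of the space of phases *)

Section Family.
Context {R : realType} {n : nat}.
Local Open Scope complex_scope.

Lemma vecR_inj : injective (@vecR R n).
Proof.
move=> A B /eq_row_mx[/(congr1 vec_mx) + /(congr1 vec_mx)].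
rewrite !mxvecK => /matrixP Re_eq /matrixP Im_eq.
apply/matrixP => i j; apply/eqP; rewrite eq_complex.
by have := Re_eq i j; have := Im_eq i j; rewrite !mxE => -> ->; rewrite !eqxx.
Qed.

Lemma vecR_fhat_linear : linear (fun X : 'M[R]_n => vecR (fhat X)).
Proof.
move=> a X Y.
have fl : fhat (a *: X + Y) = a%:C *: fhat X + fhat Y.
  rewrite /fhat scalemxAl -mulmxDl; congr (_ *m _).
  by apply/matrixP => i j; rewrite !mxE rmorphD rmorphM.
rewrite /vecR fl scale_row_mx add_row_mx -!linearP; congr row_mx.
  congr (mxvec _); apply/matrixP => i j; rewrite !mxE;
    move: (\sum_j0 _) (\sum_j0 _).
  by move=> [x1 x2] [y1 y2] /=; rewrite mul0r subr0.
congr (mxvec _); apply/matrixP => i j; rewrite !mxE;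
  move: (\sum_j0 _) (\sum_j0 _).
by move=> [x1 x2] [y1 y2] /=; rewrite mul0r addr0.
Qed.

Lemma vecR_fourier_phase X : vecR (fourier_phase X) =
  torus (Num.sqrt (n%:R : R))^-1
    (mxvec (\matrix_(i < n, j < n) (2 * pi / n%:R * i%:R * j%:R))) (mxvec X).
Proof.
by rewrite /vecR; congr row_mx; apply/rowP => s; case/mxvec_indexP: s => i j;
  rewrite [RHS]mxE !mxvecE !mxE cexp_i /expi; simpc => /=;
  rewrite ?(cosD, sinD); ring.
Qed.

End Family.

Lemma PCM_familyE (R : realType) (p k : nat) : prime p -> (1 <= k)%N ->
  PCM_family R p k = [set vecR (fourier_phase X) |
    X in [set X : 'M[R]_(p ^ k) | biperiodic p k X /\
      forall i j : 'I_(p ^ k), i = 0%N :> nat \/ j = 0%N :> nat -> X i j = 0]].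
Proof.
move=> p_prime k_gt0.
apply/seteqP; split=> [_ [P /(PCM_spaceP p_prime k_gt0)[X [Xp X0 ->]] <-]|].
  by exists X => //; rewrite (fhatK p_prime erefl) hadamard_EXP.
move=> _ [X [Xp X0] <-]; exists (fhat X).
  by apply/(PCM_spaceP p_prime k_gt0); exists X.
by rewrite (fhatK p_prime erefl) hadamard_EXP.
Qed.

(** * Dimension, manifold structure and Hadamard property *)

Theorem theorem6p1 (R : realType) (p k : nat) (hp : prime p) (hk : (1 <= k)%N) :
  let F : 'M[R[i]]_(p ^ k) := fourier (p ^ k) in
  exists V : {vspace 'rV[R]_(p ^ k * p ^ k + p ^ k * p ^ k)},
    [/\ vecR @` PCM_space R p k = [set v | v \in V],
        (\dim V)%:Z = defect F,
        smooth_submanifold (\dim V) (PCM_family R p k),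
        PCM_family R p k (vecR F)
      & forall v, PCM_family R p k v ->
          exists A : 'M[R[i]]_(p ^ k),
            [/\ v = vecR A, complex_hadamard A & dephased_wrt F A]].
Proof.
move=> F; have n_gt0 : (0 < p ^ k)%N by rewrite expn_gt0 prime_gt0.
have [K dK KP'] :=
  defect_unitary n_gt0 (fourier_unitary hp erefl : F \is unitarymx).
have KP X : X \in K <-> biperiodic p k X /\
    forall i j : 'I_(p ^ k), i = 0%N :> nat \/ j = 0%N :> nat -> X i j = 0.
  by rewrite KP' (unitary_flux_fourier hp erefl).
pose hL := GRing.isLinear.Build _ _ _ _ _ (@vecR_fhat_linear R (p ^ k)).
pose hl : {linear 'M[R]_(p ^ k) -> _} := HB.pack (fun X => vecR (fhat X)) hL.
have hE X : linfun hl X = vecR (fhat X) by rewrite lfunE.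
(* Multiplication by [F] recovers the phases from [fhat X], so no dimension is lost. *)
have dimh : \dim (linfun hl @: K)%VS = \dim K.
  apply/limg_dim_eq/eqP; rewrite -subv0; apply/subvP => X.
  rewrite memv_cap memv_ker memv0 => /andP[_ /eqP X0].
  have : vecR (fhat X) = vecR (fhat 0) by rewrite -!hE X0 linear0.
  move=> /vecR_inj /(congr1 (mulmx^~ F)); rewrite !(fhatK hp erefl).
  by move=> /map_mx_inj ->.
have dimS : \dim (linfun (@mxvec R (p ^ k) (p ^ k)) @: K)%VS = \dim K.
  apply/limg_dim_eq/eqP; rewrite -subv0; apply/subvP => X.
  rewrite memv_cap memv_ker memv0 lfunE /= => /andP[_ /eqP X0].
  by rewrite -[X]mxvecK X0 linear0.
have famE := PCM_familyE R hp hk.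
exists (linfun hl @: K)%VS; split.
- apply/seteqP; split=> [_ [P /(PCM_spaceP hp hk)[X [Xp X0 ->]] <-]|v /=].
    by apply/memv_imgP; exists X; [apply/KP|rewrite hE].
  move=> /memv_imgP[X /KP[Xp X0] ->]; rewrite hE; exists (fhat X) => //.
  by apply/(PCM_spaceP hp hk); exists X.
- by rewrite dimh.
- set S := (linfun (@mxvec R (p ^ k) (p ^ k)) @: K)%VS in dimS.
  have SP x : x \in S <-> vec_mx x \in K.
    split=> [/memv_imgP[X XK ->]|xK]; first by rewrite lfunE /= mxvecK.
    by apply/memv_imgP; exists (vec_mx x) => //; rewrite lfunE /= vec_mxK.
  rewrite dimh -dimS.
  pose theta : 'M[R]_(p ^ k) :=
    \matrix_(i, j) (2 * pi / (p ^ k)%:R * i%:R * j%:R).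
  have -> : PCM_family R p k =
    [set torus (Num.sqrt (p ^ k)%:R)^-1 (mxvec theta) x |
      x in [set x | x \in S]].
    rewrite famE; apply/seteqP; split=> [_ [X /KP XK <-]|_ [x /SP xK <-]].
      by exists (mxvec X) => /=; [apply/SP;
        rewrite mxvecK|rewrite vecR_fourier_phase].
    by exists (vec_mx x); [exact/KP|rewrite vecR_fourier_phase vec_mxK].
  apply: torus_submanifold; first by rewrite invr_gt0 sqrtr_gt0 ltr0n.
  move=> x e /SP/KP[xp x0] elt xe; apply/SP/KP; split.
    apply: biperiodic_round xp _ _ => i j; first by rewrite mxE elt.
    by have [m] := xe (mxvec_index i j); rewrite !mxE => ->; exists m.
  move=> i j ij; have [m xm] := xe (mxvec_index i j).
  (* The entry of [x] is 0 here, so that of [e] is a multiple of [2 * pi] smaller than [pi / 2]. *)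
  apply: (small_multiple_2pi_eq0 (m := m)); last first.
    by rewrite mxE -xm; have := x0 i j ij; rewrite mxE.
  by have := elt (mxvec_index i j); have := pi_gt0 R; rewrite mxE; lra.
- rewrite famE; exists 0; last by rewrite fourier_phase0.
  by split=> [b i i' l l' _ _ _|i j _]; rewrite !mxE.
rewrite famE => _ [X [Xp X0] <-]; exists (fourier_phase X); split=> //.
  split=> [|i j]; first exact: fourier_phase_unitary Xp.
  exact: norm_fourier_phase.
by move=> i j ij; rewrite [LHS]mxE X0// expi0 mulr1.
Qed.
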